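(* If $g_i(p)=p^{c_i}$, $i=1,2$, for $0<c_2<c_1<1$, then deductible insurance is optimal.
   Context: Let $(\Omega,\mathcal{F},\mathbb{P})$ be a probability space. For an almost surely finite random variable $Y$ let $S_Y(t)=\mathbb{P}(Y>t)$. A concave distortion is a non-decreasing concave function $g:[0,1]\to[0,1]$ with $g(0)=0$, $g(1)=1$; its distortion risk measure is $H_g(Y)=\int_{-\infty}^0(g[S_Y(t)]-1)\,dt+\int_0^\infty g[S_Y(t)]\,dt$. An individual (agent 2) faces a random loss $X\ge 0$ and may buy insurance from an insurer (agent 1, with initial loss $0$). The distortions of insurer and buyer are $g_1$ and $g_2$; $H_{g_2}(X)$ is assumed finite. There are constants $0<b_1<\theta$. The preference functionals (to be minimized) are $$V_1(Y)=(1+b_1)H_{g_1}(Y)-(1+\theta)\,\mathbb{E}Y,\qquad V_2(Y)=H_{g_2}(Y)-(1+\theta)\,\mathbb{E}Y.$$ An allocation is a pair $(Y_1,Y_2)$ with $Y_1+Y_2=X$ and $V_1(Y_1),V_2(Y_2)$ finite. It is Pareto optimal if any allocation $(Z_1,Z_2)$ with $V_i(Z_i)\le V_i(Y_i)$, $i=1,2$, satisfies $V_i(Z_i)=V_i(Y_i)$, $i=1,2$. ''Deductible insurance is optimal'' means: there is a deductible $d\in[0,\infty]$ such that, with $f^*(x)=(x-d)_+$ (and $f^*\equiv 0$ when $d=\infty$), the allocation $(f^*(X),X-f^*(X))$ is Pareto optimal. *)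

(* Defs.v *)
From HB Require Import structures.
From mathcomp Require Import all_boot all_order all_algebra.
From mathcomp Require Import all_classical all_reals all_analysis.
From mathcomp Require Import measurable_realfun.
Import Order.TTheory GRing.Theory Num.Theory.

Set Implicit Arguments.
Unset Strict Implicit.
Unset Printing Implicit Defensive.

Local Open Scope classical_set_scope.
Local Open Scope ring_scope.

(* Distortions are total functions on R of which only the values on [0, 1]
   matter; concavity of g is convexity of - g. *)
Definition concave_distortion (R : realType) (g : R -> R) : Prop :=
  [/\ {in `[0, 1], forall p, g p \in `[0, 1]},
      {in `[0, 1] &, {homo g : p q / p <= q}},
      convex_function (`[0, 1]%classic : set R^o) (fun p => - g p),
      g 0 = 0
    & g 1 = 1].

Lemma powR_concave_distortion (R : realType) (c : R) :
  0 < c < 1 -> concave_distortion (fun p => p `^ c).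
Proof.
move=> /andP[c0 c1].
have cN0 : c != 0 by rewrite gt_eqF.
have mono : {in `[0, 1] &, {homo (fun p : R => p `^ c) : p q / p <= q}}.
  move=> p q; rewrite !in_itv/= => /andP[p0 _] /andP[q0 _] pq.
  by rewrite ge0_ler_powR ?nnegrE// ltW.
split => //; last 2 first.
- by rewrite powR0.
- by rewrite powR1.
- move=> p p01; rewrite in_itv/= powR_ge0/= (_ : 1 = 1 `^ c);
    last by rewrite powR1.
  apply: mono => //; first by rewrite in_itv/= lexx ler01.
  by move: p01; rewrite in_itv/= => /andP[].
move=> t x y; rewrite !inE/= !in_itv/= => /andP[x0 _] /andP[y0 _].
have ci1 : 1 <= c^-1 by rewrite invf_ge1// ltW.
have mem0 (z : R) : z `^ c \in (`[0, +oo[%classic : set R).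
  by rewrite inE/= in_itv/= powR_ge0.
have := convex_powR ci1 t (mem0 x) (mem0 y).
rewrite /= -!powRrM mulfV// !powRr1// => cvx.
rewrite !convRE !mulrN -opprD lerN2.
have conv_ge0 (u v : R) : 0 <= u -> 0 <= v -> 0 <= t%:num * u + (1 - t%:num) * v.
  by move=> u0 v0; rewrite addr_ge0// mulr_ge0// subr_ge0.
rewrite -[leLHS]powRr1 ?conv_ge0 ?powR_ge0// -(mulVf cN0) powRrM.
by rewrite ge0_ler_powR ?nnegrE ?powR_ge0 ?(ltW c0)//; exact: conv_ge0.
Qed.

Section insurance.
Context (dT : measure_display) (T : measurableType dT) (R : realType).
Context (P : probability T R).
Implicit Types (g : R -> R) (X Y Z : {RV P >-> R}).

(* [ccdf Y t] is P(Y > t). The first integral is <= 0, the second >= 0, and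
   -oo + +oo = -oo in \bar R: the sum is finite iff both integrals are. *)
Definition distortion_risk g Y : \bar R :=
  (\int[lebesgue_measure]_(t in `]-oo, 0%R]) (g (fine (ccdf Y t)) - 1)%:E
   + \int[lebesgue_measure]_(t in `[0%R, +oo[) (g (fine (ccdf Y t)))%:E)%E.

(* ['E_P[Y]] is finite iff Y is integrable, so for
   b1, theta > 0 these are finite iff both of their terms are. *)
Definition V_insurer (b1 theta : R) g Y : \bar R :=
  ((1 + b1)%:E * distortion_risk g Y - (1 + theta)%:E * 'E_P[Y])%E.

Definition V_buyer (theta : R) g Y : \bar R :=
  (distortion_risk g Y - (1 + theta)%:E * 'E_P[Y])%E.

Definition allocation (V1 V2 : {RV P >-> R} -> \bar R) X Y1 Y2 : Prop :=
  [/\ {ae P, forall w, Y1 w + Y2 w = X w},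
      V1 Y1 \is a fin_num
    & V2 Y2 \is a fin_num].

Definition pareto_optimal (V1 V2 : {RV P >-> R} -> \bar R) X Y1 Y2 : Prop :=
  allocation V1 V2 X Y1 Y2 /\
  forall Z1 Z2, allocation V1 V2 X Z1 Z2 ->
    (V1 Z1 <= V1 Y1)%E -> (V2 Z2 <= V2 Y2)%E ->
    V1 Z1 = V1 Y1 /\ V2 Z2 = V2 Y2.

End insurance.

(* The deductible is used at d >= 0 only; d = +oo means no insurance. *)
Definition deductible (R : realType) (d : \bar R) (x : R) : R :=
  if d is r%:E then Num.max (x - r) 0 else 0.

Lemma measurable_deductible (R : realType) (d : \bar R) :
  measurable_fun [set: R] (deductible d).
Proof.
case: d => [r| |]; [|exact: measurable_cst..].
by apply: measurable_maxr => //; exact: measurable_funB.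
Qed.

HB.instance Definition _ (R : realType) (d : \bar R) :=
  isMeasurableFun.Build _ _ _ _ (deductible d) (@measurable_deductible R d).

Definition deductible_insurance_optimal (dT : measure_display)
    (T : measurableType dT) (R : realType) (P : probability T R)
    (V1 V2 : {RV P >-> R} -> \bar R) (X : {RV P >-> R}) : Prop :=
  exists2 d : \bar R, (0 <= d)%E &
    let Y1 : {RV P >-> R} := deductible d \o X in
    pareto_optimal V1 V2 X Y1 (X \- Y1).

(* Main.v *)
From HB Require Import structures.
Require Import Defs.
From mathcomp Require Import all_boot all_order all_algebra.
From mathcomp Require Import all_classical all_reals all_analysis.
From mathcomp Require Import measurable_realfun ring lra.
Import Order.TTheory GRing.Theory Num.Theory.
Import numFieldNormedType.Exports.

(** Why deductibles are optimal.

    Moving a constant payment from one party to the other changes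
    [theta * V_insurer + (theta - b1) * V_buyer] by nothing, and both weights
    are positive; hence an allocation minimising this weighted sum is Pareto
    optimal.  Since the expectations of the two shares add up to that of [X],
    the sum is, up to a constant and to the factor [theta - b1], the sum of the
    Choquet integrals of
    - the first share, for the loaded distortion
      [a p ^ c1 - (a - 1) p], with [a = (1 + b1) theta / (theta - b1) > 1];
    - the second share, for the distortion [p ^ c2].
    The loaded distortion need not be monotone, but it is concave with value 0
    at 0 and 1 at 1.

    The lower bound.  Let [h] be the minimum of these two functions
    ([envelope]).  It is concave and at most 1, hence again a concave
    distortion, and Choquet integrals for a concave distortion are subadditive
    ([choquet_subadditive]).  So every allocation costs at least the Choquet
    integral of [X] for [h] ([envelope_bound]).

    The bound is attained.  The layer of [X] at height [t] costs [h (P (X > t))]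
    provided it goes to whichever party has the smaller distortion at
    [P (X > t)].  On (0, 1), divided by [p ^ c2] and written in the variable
    [u = p ^ (c1 - c2)], the difference of the two distortions is a concave
    function of [u] that is -1 at 0 and vanishes at 1; so it is negative up to
    some point and nonnegative afterwards ([loaded_lt_power_down]).  As
    [P (X > t)] decreases in [t], the insurer therefore takes exactly the high
    layers, and this is a deductible ([exists_deductible],
    [choquet_deductible]).

    Subadditivity is proved from the case [p |-> min p s].  There the Choquet
    integral of [Z] is the minimum over [m] of [E max (Z, m) - (1 - s) m],
    attained at a quantile, which is visibly subadditive in [Z].  A general
    concave distortion is the limit of its piecewise linear interpolations,
    which are nonnegative combinations of such functions and bound it from
    below. *)

Set Implicit Arguments.
Unset Strict Implicit.
Unset Printing Implicit Defensive.

Local Open Scope classical_set_scope.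
Local Open Scope ring_scope.

(** * Tail functions *)

Section tail.
Context (dT : measure_display) (T : measurableType dT) (R : realType).
Context (P : probability T R).
Implicit Types (Y Z : {RV P >-> R}) (t : R).

Definition tail Y t : R := fine (ccdf Y t).

Lemma ccdf_tail Y t : ccdf Y t = (tail Y t)%:E.
Proof. by rewrite /tail fineK// /ccdf fin_num_measure. Qed.

Lemma tail_ge0 Y t : 0 <= tail Y t.
Proof. by rewrite fine_ge0. Qed.

Lemma tail_le1 Y t : tail Y t <= 1.
Proof. by rewrite -lee_fin -ccdf_tail probability_le1. Qed.

Lemma tail_nonincreasing Y : nonincreasing_fun (tail Y).
Proof. by move=> s t st; rewrite -lee_fin -!ccdf_tail ccdf_nonincreasing. Qed.

Lemma measurable_tail Y : measurable_fun [set: R] (tail Y).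
Proof. by apply: nonincreasing_measurable => //; exact: tail_nonincreasing. Qed.

(** Stated on events rather than on variables, so that one lemma serves almost
    sure inequalities, shifts and truncations. *)
Lemma tail_le Y Z t t' : {ae P, forall w, t < Y w -> t' < Z w} ->
  tail Y t <= tail Z t'.
Proof.
move=> [N [mN N0 sN]]; rewrite -lee_fin -!ccdf_tail /ccdf /distribution/=.
rewrite /pushforward.
have mA (U : {RV P >-> R}) u : measurable (U @^-1` `]u, +oo[).
  exact: measurable_funPTI.
rewrite -[leRHS]adde0 -N0.
apply: (@le_trans _ _ (P (Z @^-1` `]t', +oo[ `|` N))).
  rewrite le_measure ?inE//; first exact: measurableU.
  move=> w /=; rewrite !in_itv/= !andbT => tY.
  have [|tZ] := boolP (t' < Z w); first by left.
  by right; apply: sN => /= /(_ tY); rewrite (negbTE tZ).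
exact: measureU2.
Qed.

Lemma tail_eq Y Z t t' : {ae P, forall w, (t < Y w) = (t' < Z w)} ->
  tail Y t = tail Z t'.
Proof.
move=> YZ; apply/eqP; rewrite eq_le !tail_le//.
  by apply: filterS YZ => w ->.
by apply: filterS YZ => w ->.
Qed.

Lemma tail_eq1 Y t : {ae P, forall w, t < Y w} -> tail Y t = 1.
Proof.
move=> tY; apply/eqP; rewrite eq_le tail_le1/= -lee_fin.
rewrite -(@probability_setT _ _ _ P).
have -> : P [set: T] = (tail (cst (t + 1)) t : R)%:E.
  rewrite -ccdf_tail /ccdf /distribution /pushforward; congr (P _).
  by apply/esym/seteqP; split => // w _ /=; rewrite in_itv/= andbT ltrDl ltr01.
by rewrite lee_fin; apply: tail_le; apply: filterS tY => w.
Qed.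

Lemma tail_eq0 Y t : (forall w, Y w <= t) -> tail Y t = 0.
Proof.
move=> Yt; rewrite /tail /ccdf /distribution /pushforward.
rewrite (_ : _ @^-1` _ = set0) ?measure0//.
by apply/seteqP; split => // w /=; rewrite in_itv/= andbT ltNge Yt.
Qed.

End tail.

(** * Choquet integrals over layers *)

Section layer.
Context (dT : measure_display) (T : measurableType dT) (R : realType).
Context (P : probability T R).
Implicit Types (Y Z : {RV P >-> R}) (g : R -> R) (t : R).
Local Notation leb := (@lebesgue_measure R).

(** In extended reals an infinite integral absorbs, so a sum of integrals is
    finite only if both are, and a finite integral of a real function forces
    absolute integrability. *)
Lemma integrable_split0 (f : R -> R) (I := (\int[leb]_(t in `]-oo, 0%R[) (f t)%:E
    + \int[leb]_(t in `[0%R, +oo[) (f t)%:E)%E) :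
  measurable_fun [set: R] f -> (leb.-integrable [set: R] (EFin \o f) <->
    I \is a fin_num) /\
  (leb.-integrable [set: R] (EFin \o f) -> I = (Rintegral leb [set: R] f)%:E).
Proof.
move=> mf.
have cover : [set: R] = `]-oo, 0%R[ `|` `[0%R, +oo[.
  by apply/seteqP; split => // t _ /=; rewrite !in_itv/= andbT; case: ltP; [left|right].
have disj : [disjoint `]-oo, 0%R[%classic & (`[0%R, +oo[%classic : set R)].
  apply/disj_setPS => t /= []; rewrite !in_itv/= andbT => t0.
  by rewrite leNgt t0.
have mE (D : set R) : measurable D -> measurable_fun D (EFin \o f).
  by move=> mD; apply/measurable_EFinP; exact: measurable_funTS.
have IE : leb.-integrable [set: R] (EFin \o f) -> I = (Rintegral leb [set: R] f)%:E.
  move=> fi; rewrite /Rintegral fineK; last exact: integrable_fin_num.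
  rewrite {1}cover integral_setU_EFin//; first by apply: measurable_funTS.
split=> //; split=> [fi|]; first by rewrite IE.
rewrite fin_numD -!integral_fin_num_abs//; try exact: measurable_funTS.
move=> /andP[fn fp]; apply/integrableP; split; first exact: mE.
rewrite cover ge0_integral_setU//; first by rewrite lte_add_pinfty.
by rewrite -cover; apply: measurableT_comp => //; exact: mE.
Qed.

(** Subtracting [g 1] below 0 puts both integrals of a distortion risk measure
    into a single one over the line, which is linear in [g]. With [g 1] in
    place of 1, this also makes sense for functions that are not normalised,
    such as [p |-> min p s]. *)
Definition layer g Y t : R := g (tail Y t) - g 1 * (t < 0)%R%:R.

Definition choquet g Y : R := Rintegral leb [set: R] (layer g Y).

Definition layer_integrable g Y : Prop :=
  leb.-integrable [set: R] (EFin \o layer g Y).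

Lemma layer_pos g Y t : 0 <= t -> layer g Y t = g (tail Y t).
Proof. by move=> t0; rewrite /layer ltNge t0/= mulr0 subr0. Qed.

Lemma layer_neg g Y t : t < 0 -> layer g Y t = g (tail Y t) - g 1.
Proof. by move=> t0; rewrite /layer t0/= mulr1. Qed.

Lemma measurable_layer g Y : measurable_fun [set: R] (g \o tail Y) ->
  measurable_fun [set: R] (layer g Y).
Proof.
move=> mg; apply: measurable_funB => //; apply: measurable_funM => //.
rewrite (_ : (fun t => _) = \1_`]-oo, (0:R)[); first exact: measurable_indic.
by apply/funext => t; rewrite indicE mem_setE in_itv.
Qed.

(** The two half-lines of the risk measure overlap at 0 and the layer function
    jumps there, but a point has Lebesgue measure 0. *)
Lemma distortion_risk_layer g Y : g 1 = 1 ->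
  measurable_fun [set: R] (g \o tail Y) ->
  (layer_integrable g Y <-> distortion_risk g Y \is a fin_num) /\
  (layer_integrable g Y -> distortion_risk g Y = (choquet g Y)%:E).
Proof.
move=> g1 mg; have ml := measurable_layer mg.
have [iff IE] := integrable_split0 ml.
have -> : distortion_risk g Y =
  (\int[leb]_(t in `]-oo, 0%R[) (layer g Y t)%:E
    + \int[leb]_(t in `[0%R, +oo[) (layer g Y t)%:E)%E; last by split.
rewrite /distortion_risk; congr (_ + _)%E; last first.
  apply: eq_integral => t; rewrite inE/= in_itv/= andbT => t0.
  by rewrite layer_pos.
rewrite -integral_itv_bndo_bndc.
  apply: eq_integral => t; rewrite inE/= in_itv/= => t0.
  by rewrite layer_neg// g1.
apply/measurable_EFinP; apply: measurable_funTS.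
exact: measurable_funB.
Qed.

Lemma expectation_choquet Y : P.-integrable [set: T] (EFin \o Y) ->
  layer_integrable id Y /\ ('E_P[Y] = (choquet id Y)%:E)%E.
Proof.
move=> iY.
have ml : measurable_fun [set: R] (layer id Y).
  by apply: measurable_layer; exact: measurable_tail.
have [iff IE] := integrable_split0 ml.
have EE : ('E_P[Y] = \int[leb]_(t in `]-oo, 0%R[) (layer id Y t)%:E
    + \int[leb]_(t in `[0%R, +oo[) (layer id Y t)%:E)%E.
  rewrite expectation_cdf_ccdf; last first.
    by have /Lfun1_integrable := iY; rewrite inE.
  rewrite addeC; congr (_ + _)%E; last first.
    apply: eq_integral => t; rewrite inE/= in_itv/= andbT => t0.
    by rewrite layer_pos// ccdf_tail.
  rewrite -integral_ge0N//; apply: eq_integral => t; rewrite inE/= in_itv/= => t0.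
  by rewrite layer_neg// cdf_1_ccdf ccdf_tail -EFinB -EFinN opprB.
have fE : ('E_P[Y])%E \is a fin_num.
  by apply: expectation_fin_num; apply/Lfun1_integrable.
have li : layer_integrable id Y by apply/iff; rewrite -EE.
by split=> //; rewrite EE; exact: IE.
Qed.

(** Equality at 1 makes the comparison of distortions carry over to layers on
    the negative half-line, where [g 1] is subtracted. *)
Lemma layer_integrable_between g1 g2 f Y :
  measurable_fun [set: R] (f \o tail Y) ->
  g1 1 = f 1 -> g2 1 = f 1 ->
  (forall p, 0 <= p <= 1 -> g1 p <= f p <= g2 p) ->
  layer_integrable g1 Y -> layer_integrable g2 Y -> layer_integrable f Y.
Proof.
move=> mf g11 g21 fb i1 i2.
have tl01 t : 0 <= tail Y t <= 1 by rewrite tail_ge0 tail_le1.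
have i12 : leb.-integrable [set: R]
    (EFin \o (fun t => `|layer g1 Y t| + `|layer g2 Y t|)).
  by apply: (integrableD _ (integrable_norm i1) (integrable_norm i2)).
apply: (le_integrable _ _ _ i12) => //.
  by apply/measurable_EFinP; exact: measurable_layer.
move=> t _; rewrite /= !lee_fin [leRHS]ger0_norm ?addr_ge0//.
have /andP[f1 f2] : layer g1 Y t <= layer f Y t <= layer g2 Y t.
  by have /andP[] := fb _ (tl01 t); rewrite /layer g11 g21 !lerD2r => -> ->.
rewrite ler_norml; apply/andP; split.
  rewrite (le_trans _ f1)// lerNl.
  have := ler_norm (- layer g1 Y t); rewrite normrN.
  by have := normr_ge0 (layer g2 Y t); lra.
by have := ler_norm (layer g2 Y t); have := normr_ge0 (layer g1 Y t); lra.
Qed.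

Lemma le_choquet g f Y : f 1 = g 1 ->
  (forall p, 0 <= p <= 1 -> g p <= f p) ->
  layer_integrable g Y -> layer_integrable f Y -> choquet g Y <= choquet f Y.
Proof.
move=> fg1 gf ig jf; apply: le_Rintegral => // t _.
by rewrite /layer fg1 lerD2r gf// tail_ge0 tail_le1.
Qed.

Lemma choquetD g f Y : layer_integrable g Y -> layer_integrable f Y ->
  layer_integrable (g \+ f) Y /\
  choquet (g \+ f) Y = choquet g Y + choquet f Y.
Proof.
move=> ig jf.
have E : layer (g \+ f) Y = layer g Y \+ layer f Y.
  by apply/funext => t; rewrite /layer/= mulrDl opprD addrACA.
split; last by rewrite /choquet E RintegralD.
by rewrite /layer_integrable E; exact: (integrableD _ ig jf).
Qed.

Lemma choquetZ k g Y : layer_integrable g Y ->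
  layer_integrable (k \*o g) Y /\ choquet (k \*o g) Y = k * choquet g Y.
Proof.
move=> ig.
have E : layer (k \*o g) Y = k \*o layer g Y.
  by apply/funext => t; rewrite /layer/= mulrBr mulrA.
split; last by rewrite /choquet E RintegralZl.
by rewrite /layer_integrable E; exact: (integrableZl _ _ ig).
Qed.

End layer.

(** * Subadditivity for a truncated identity *)

Section expected_shortfall.
Context (dT : measure_display) (T : measurableType dT) (R : realType).
Context (P : probability T R).
Implicit Types (X Y Z : {RV P >-> R}) (s m : R).

Lemma tail_max Z m t :
  tail (Z \max cst m : {RV P >-> R}) t = if t < m then 1 else tail Z t.
Proof.
have [tm|mt] := ltP t m.
  by apply: tail_eq1; apply: aeW => w /=; rewrite lt_max tm orbT.
by apply: tail_eq; apply: aeW => w /=; rewrite lt_max [t < m]ltNge mt orbF.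
Qed.

Lemma tail_cst m t : tail (cst m : {RV P >-> R}) t = (t < m)%R%:R.
Proof.
have [tm|mt] := ltP t m; first by apply: tail_eq1; exact: aeW.
exact: tail_eq0.
Qed.

(** The infimum of the [t] with [tail Z t <= s] is such a quantile; right
    continuity of the tail function gives the inequality at that point itself. *)
Lemma tail_quantile Z s : 0 < s < 1 -> exists m,
  (forall t, t < m -> s <= tail Z t) /\ (forall t, m <= t -> tail Z t <= s).
Proof.
move=> /andP[s0 s1]; pose A := [set t | tail Z t <= s].
have [u uA] : A !=set0.
  have [//|nA] := pselect (A !=set0).
  exfalso; have : (s%:E <= 0 :> \bar R)%E.
    apply: (cvge_ge _ (cvg_ccdfy0 Z)); apply: nearW => t.
    rewrite ccdf_tail lee_fin leNgt; apply/negP => ts.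
    by apply: nA; exists t; exact: ltW.
  by rewrite lee_fin leNgt s0.
have [l lA] : exists l, ~ A l.
  apply/existsNP => allA.
  have : (1 <= s%:E :> \bar R)%E.
    apply: (cvge_le _ (cvg_ccdfNy1 Z)); apply: nearW => t.
    by rewrite ccdf_tail lee_fin; exact: allA.
  by rewrite lee_fin leNgt s1.
have lbA : lbound A l.
  move=> t At; rewrite leNgt; apply/negP => tl; apply: lA.
  by apply: le_trans At; exact/tail_nonincreasing/ltW.
have hA : has_inf A by split; [exists u|exists l].
exists (inf A); split=> t.
  move=> tA; rewrite leNgt; apply/negP => ts.
  by have := inf_lbound hA.2 (ltW ts); rewrite leNgt tA.
move=> At; rewrite (le_trans (tail_nonincreasing _ At))//.
rewrite -lee_fin -ccdf_tail; apply: (cvge_le _ (@ccdf_right_continuous _ _ _ _ Z _)).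
near=> r; rewrite ccdf_tail lee_fin.
have Ar : inf A < r by near: r; exact: nbhs_right_gt.
have [v Av vr] := inf_lt hA.1 Ar.
by apply: le_trans Av; exact/tail_nonincreasing/ltW.
Unshelve. all: by end_near. Qed.

Definition cap s (p : R) : R := Num.min p s.

Lemma measurable_cap s Z : measurable_fun [set: R] (cap s \o tail Z).
Proof. by apply: measurable_minr => //; exact: measurable_tail. Qed.

Lemma integrable_max Z m : P.-integrable [set: T] (EFin \o Z) ->
  P.-integrable [set: T] (EFin \o (Z \max cst m)).
Proof.
move=> iZ.
have im : P.-integrable [set: T] (EFin \o (fun w => `|Z w| + `|m|)).
  exact: (integrableD _ (integrable_norm iZ)
    (finite_measure_integrable_cst P `|m| measurableT)).
apply: (le_integrable _ _ _ im) => //.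
  by apply/measurable_EFinP; exact: measurable_maxr.
move=> w _ /=; rewrite lee_fin [leRHS]ger0_norm ?addr_ge0//.
by rewrite /Num.max; case: ifP => _; rewrite ?lerDr ?lerDl.
Qed.

Lemma integrable_cst m : P.-integrable [set: T] (EFin \o cst m).
Proof. exact: finite_measure_integrable_cst. Qed.

(** The objective [s m + E (Z - m)_+] whose minimum over [m] is [s] times the
    expected shortfall of [Z] at level [s]; since
    [E (Z - m)_+ = E max (Z, m) - m], it involves an expectation of a single
    truncated variable. *)
Definition shortfall s Z m : R :=
  choquet id (Z \max cst m : {RV P >-> R}) - (1 - s) * m.

Lemma choquet_cst m : choquet id (cst m : {RV P >-> R}) = m.
Proof.
apply: EFin_inj; rewrite -(expectation_choquet (integrable_cst m)).2.
exact: expectation_cst.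
Qed.

(** Writing [(1 - s) m] as a Choquet integral of the constant [m] makes the
    objective an integral of layers, so that minimising over [m] becomes a
    pointwise comparison: below [m] the layer is [s], above it is the tail. *)
Lemma shortfallE s Z m : P.-integrable [set: T] (EFin \o Z) ->
  let f t := s * (t < m)%R%:R + (if t < m then 0 else tail Z t) - s * (t < 0)%R%:R in
  lebesgue_measure.-integrable [set: R] (EFin \o f) /\
  shortfall s Z m = Rintegral lebesgue_measure [set: R] f.
Proof.
move=> iZ f.
have [i1 _] := expectation_choquet (integrable_max m iZ).
have [i2 _] := expectation_choquet (integrable_cst m).
have i3 : lebesgue_measure.-integrable [set: R]
    (EFin \o (fun t => (1 - s) * layer id (cst m : {RV P >-> R}) t)).
  exact: (integrableZl _ _ i2).
have fE : f = (fun t => layer id (Z \max cst m : {RV P >-> R}) t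
    - (1 - s) * layer id (cst m : {RV P >-> R}) t).
  apply/funext => t; rewrite /f /layer tail_max tail_cst.
  by case: ifP => _ /=; ring.
rewrite fE; split; first exact: (integrableB _ i1 i3).
rewrite RintegralB//; congr (_ - _); rewrite RintegralZl//.
by congr (_ * _); rewrite -[LHS]choquet_cst.
Qed.

(** Domination by the layers of [Z] itself: [min p s <= p] and
    [s - min p s <= 1 - p]. *)
Lemma layer_integrable_cap s Z : 0 < s <= 1 ->
  P.-integrable [set: T] (EFin \o Z) -> layer_integrable (cap s) Z.
Proof.
move=> /andP[s0 s1] iZ; have [iid _] := expectation_choquet iZ.
rewrite /layer_integrable; apply: (le_integrable _ _ _ iid) => //.
  by apply/measurable_EFinP; apply: measurable_layer; exact: measurable_cap.
move=> t _; rewrite /= lee_fin.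
have t0 := tail_ge0 Z t; have t1 := tail_le1 Z t.
have [t0'|t0'] := ltP t 0.
  rewrite !layer_neg// [leLHS]ler0_norm ?[leRHS]ler0_norm ?subr_le0 /cap //=.
    by rewrite !minElt; do 2 case: ltP => ?; lra.
  by rewrite !minElt; do 2 case: ltP => ?; lra.
have c0 : 0 <= cap s (tail Z t) by rewrite /cap le_min t0 ltW.
by rewrite !layer_pos// (ger0_norm c0) ger0_norm// /cap ge_min lexx.
Qed.

Lemma choquet_cap_le s Z m : 0 < s <= 1 ->
  P.-integrable [set: T] (EFin \o Z) -> choquet (cap s) Z <= shortfall s Z m.
Proof.
move=> s01 iZ; have [i1 ->] := shortfallE s m iZ.
apply: le_Rintegral => //; first exact: layer_integrable_cap.
move=> t _; rewrite /layer {2}/cap min_r; last by case/andP: s01.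
rewrite lerD2r; case: ifP => _; rewrite /cap.
  by rewrite mulr1 addr0 ge_min lexx orbT.
by rewrite mulr0 add0r ge_min lexx.
Qed.

Lemma choquet_cap_attained s Z : 0 < s < 1 ->
  P.-integrable [set: T] (EFin \o Z) ->
  exists m, choquet (cap s) Z = shortfall s Z m.
Proof.
move=> s01 iZ; have [m [m1 m2]] := tail_quantile Z s01; exists m.
have [_ ->] := shortfallE s m iZ; apply: eq_Rintegral => t _.
rewrite /layer {2}/cap min_r; last by case/andP: s01 => _ /ltW.
congr (_ - _); have [tm|mt] := ltP t m; rewrite /cap.
  by rewrite mulr1 addr0 min_r// m1.
by rewrite mulr0 add0r min_l// m2.
Qed.

Lemma le_choquet_tail g Y Z : layer_integrable g Y -> layer_integrable g Z ->
  (forall t, g (tail Y t) <= g (tail Z t)) -> choquet g Y <= choquet g Z.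
Proof.
by move=> iY iZ YZ; apply: le_Rintegral => // t _; rewrite /layer lerD2r.
Qed.

Lemma integrable_add Y Z : P.-integrable [set: T] (EFin \o Y) ->
  P.-integrable [set: T] (EFin \o Z) ->
  P.-integrable [set: T] (EFin \o (Y \+ Z)).
Proof. by move=> iY iZ; exact: (integrableD _ iY iZ). Qed.

Lemma choquet_idD Y Z : P.-integrable [set: T] (EFin \o Y) ->
  P.-integrable [set: T] (EFin \o Z) ->
  choquet id (Y \+ Z : {RV P >-> R}) = choquet id Y + choquet id Z.
Proof.
move=> iY iZ; apply: EFin_inj; rewrite EFinD.
have iYZ := integrable_add iY iZ.
rewrite -(expectation_choquet iY).2 -(expectation_choquet iZ).2.
rewrite -(expectation_choquet iYZ).2.
by rewrite expectationD//; exact/Lfun1_integrable.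
Qed.

Lemma choquet_id_sum X Z1 Z2 :
  P.-integrable [set: T] (EFin \o Z1) -> P.-integrable [set: T] (EFin \o Z2) ->
  {ae P, forall w, Z1 w + Z2 w = X w} ->
  choquet id Z1 + choquet id Z2 = choquet id X.
Proof.
move=> i1 i2 ZX; rewrite -choquet_idD//; apply: eq_Rintegral => t _.
rewrite /layer; congr (_ - _); apply: tail_eq.
by apply: filterS ZX => w /= ->.
Qed.

(** Take [m1], [m2] optimal for the two summands. Then [m1 + m2] is admissible
    for the sum, and
    [max (Z1 + Z2, m1 + m2) <= max (Z1, m1) + max (Z2, m2)].
    For [s = 1] there is no finite quantile in general, but the functional is
    then the expectation. *)
Lemma choquet_cap_subadditive s X Z1 Z2 : 0 < s <= 1 ->
  P.-integrable [set: T] (EFin \o X) ->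
  P.-integrable [set: T] (EFin \o Z1) -> P.-integrable [set: T] (EFin \o Z2) ->
  {ae P, forall w, Z1 w + Z2 w = X w} ->
  choquet (cap s) X <= choquet (cap s) Z1 + choquet (cap s) Z2.
Proof.
move=> /andP[s0]; rewrite le_eqVlt => /predU1P[s1|s1] iX i1 i2 ZX.
  have capE Y : choquet (cap s) Y = choquet id Y.
    apply: eq_Rintegral => t _; rewrite /layer /cap s1 minxx min_l//.
    exact: tail_le1.
  by rewrite !capE (choquet_id_sum i1 i2 ZX).
have s01 : 0 < s < 1 by rewrite s0.
have [m1 ->] := choquet_cap_attained s01 i1.
have [m2 ->] := choquet_cap_attained s01 i2.
apply: (@le_trans _ _ (shortfall s X (m1 + m2))).
  by apply: choquet_cap_le => //; rewrite s0 ltW.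
rewrite /shortfall mulrDr opprD addrACA lerD2r.
have j1 := integrable_max m1 i1; have j2 := integrable_max m2 i2.
rewrite -choquet_idD//; apply: le_choquet_tail.
- exact: (expectation_choquet (integrable_max _ iX)).1.
- exact: (expectation_choquet (integrable_add j1 j2)).1.
- move=> t; apply: tail_le; apply: filterS ZX => w /= <- /lt_le_trans; apply.
  by rewrite ge_max !lerD ?le_max ?lexx ?orbT.
Qed.

End expected_shortfall.

(** * Piecewise linear interpolation of a concave distortion *)

Lemma conv_real (R : realType) (t : R) (t0 : 0 <= t) (t1 : t <= 1) (x z : R) :
  conv (Itv01 t0 t1) (x : convex_lmodType R^o) z = t * x + (1 - t) * z :> R.
Proof. by []. Qed.

Section concave_interpolation.
Context (R : realType) (g : R -> R).
Hypothesis hg : concave_distortion g.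

Lemma concave_distortion0 : g 0 = 0. Proof. by case: hg. Qed.

Lemma concave_distortion1 : g 1 = 1. Proof. by case: hg. Qed.

Lemma concave_distortion_mono (x y : R) : 0 <= x -> x <= y -> y <= 1 -> g x <= g y.
Proof.
case: hg => _ mono _ _ _ x0 xy y1; apply: mono => //; rewrite in_itv/=.
  by rewrite x0 (le_trans xy).
by rewrite y1 (le_trans x0).
Qed.

Lemma concave_distortion_conv (t x z : R) : 0 <= t -> t <= 1 ->
  0 <= x <= 1 -> 0 <= z <= 1 -> t * g x + (1 - t) * g z <= g (t * x + (1 - t) * z).
Proof.
case: hg => _ _ cvx _ _ t0 t1 xI zI.
have xI' : x \in (`[0, 1]%classic : set R) by rewrite inE/= in_itv.
have zI' : z \in (`[0, 1]%classic : set R) by rewrite inE/= in_itv.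
have := cvx (Itv01 t0 t1) x z xI' zI'.
by rewrite conv_real convRE/= /unstable.onem !mulrN -opprD lerN2.
Qed.

(** Concavity without division, valid also for degenerate triples. *)
Lemma concave_distortion_chord (x y z : R) : 0 <= x -> x <= y -> y <= z -> z <= 1 ->
  (z - y) * g x + (y - x) * g z <= (z - x) * g y.
Proof.
move=> x0 xy yz z1.
have [xz|xz] := eqVneq x z.
  have -> : y = z by apply/eqP; rewrite eq_le yz -xz xy.
  by rewrite xz subrr !mul0r addr0.
have zx : 0 < z - x by rewrite subr_gt0 lt_neqAle xz (le_trans xy).
have t0 : 0 <= (z - y) / (z - x) by rewrite divr_ge0 ?subr_ge0// ltW// -subr_gt0.
have t1 : (z - y) / (z - x) <= 1 by rewrite ler_pdivrMr// mul1r lerD2l lerN2.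
have xI : 0 <= x <= 1 by rewrite x0 (le_trans xy)// (le_trans yz).
have zI : 0 <= z <= 1 by rewrite z1 andbT (le_trans x0)// (le_trans xy).
have := concave_distortion_conv t0 t1 xI zI.
have -> : (z - y) / (z - x) * x + (1 - (z - y) / (z - x)) * z = y.
  by field; rewrite gt_eqF.
rewrite -(ler_pM2l zx); congr (_ <= _).
by field; rewrite gt_eqF.
Qed.

Lemma concave_distortion_ge_id (x : R) : 0 <= x <= 1 -> x <= g x.
Proof.
move=> /andP[x0 x1]; have := concave_distortion_chord (lexx 0) x0 x1 (lexx 1).
by rewrite concave_distortion0 concave_distortion1 mulr0 add0r !subr0 mulr1 mul1r.
Qed.

Variable N : nat.

Definition node i : R := i%:R / N.+1%:R.

(** Extending [g] by the constant [g 1] beyond 1 makes the last slope vanish,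
    which removes the boundary term in the summation by parts below. *)
Definition slope i : R := (g (Num.min (node i.+1) 1) - g (Num.min (node i) 1)) * N.+1%:R.

Definition kink i : R := slope i - slope i.+1.

(** The interpolation of [g] at the nodes. A piecewise linear function vanishing
    at 0 and constant beyond its last kink is the sum of the functions
    [p |-> min p x] over its kinks [x], weighted by the drops in slope. *)
Definition interp p : R := \sum_(i < N.+1) kink i * Num.min p (node i.+1).

Let n0 : 0 < N.+1%:R :> R. Proof. by rewrite ltr0n. Qed.

Lemma node_ge0 i : 0 <= node i. Proof. by rewrite divr_ge0. Qed.

Lemma node_gt0 i : 0 < node i.+1. Proof. by rewrite divr_gt0. Qed.

Lemma node_last : node N.+1 = 1. Proof. by rewrite /node divff// gt_eqF. Qed.

Lemma le_node i j : (i <= j)%N -> node i <= node j.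
Proof. by move=> ij; rewrite ler_pM2r ?invr_gt0// ler_nat. Qed.

Lemma node_le1 i : (i <= N.+1)%N -> node i <= 1.
Proof. by move=> iN; rewrite -node_last le_node. Qed.

Lemma nodeS i : node i.+1 = node i + N.+1%:R^-1.
Proof. by rewrite /node -addn1 natrD mulrDl mul1r. Qed.

Lemma slope_last : slope N.+1 = 0.
Proof.
by rewrite /slope node_last minxx min_r ?subrr ?mul0r// -{1}node_last le_node.
Qed.

(** Interior kinks are nonnegative by concavity, the last one by monotonicity. *)
Lemma kink_ge0 i : (i <= N)%N -> 0 <= kink i.
Proof.
rewrite leq_eqVlt /kink => /predU1P[->|iN].
  rewrite slope_last subr0 mulr_ge0// subr_ge0.
  rewrite node_last minxx min_l ?node_le1//.
  by apply: concave_distortion_mono; rewrite ?node_ge0 ?node_le1.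
have iN1 : (i.+1 <= N.+1)%N by exact: ltnW.
have iN0 : (i <= N.+1)%N by exact: ltnW.
rewrite subr_ge0 ler_pM2r// !min_l ?node_le1//.
have /concave_distortion_chord := node_ge0 i.
move=> /(_ (node i.+1) (node i.+2) (le_node (leqnSn _)) (le_node (leqnSn _))
  (node_le1 (iN : (i.+2 <= N.+1)%N))).
rewrite !nodeS -[_ * _ + _ * _ <= _](ler_pM2l n0).
have nV : N.+1%:R * N.+1%:R^-1 = 1 :> R by rewrite mulfV// gt_eqF.
set v := N.+1%:R^-1 in nV *; set x := node i; set c := N.+1%:R in nV *.
have -> : c * ((x + v + v - (x + v)) * g x + (x + v - x) * g (x + v + v))
  = (c * v) * (g x + g (x + v + v)) by ring.
have -> : c * ((x + v + v - x) * g (x + v)) = (c * v) * (g (x + v) + g (x + v)) by ring.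
by rewrite nV !mul1r; lra.
Qed.

Lemma interp_abel (p : R) : 0 <= p <= 1 -> interp p =
  \sum_(i < N.+1) slope i * (Num.min p (node i.+1) - Num.min p (node i)).
Proof.
move=> /andP[p0 p1].
suff H m : \sum_(i < m) kink i * Num.min p (node i.+1) =
    \sum_(i < m) slope i * (Num.min p (node i.+1) - Num.min p (node i))
    - slope m * Num.min p (node m).
  by rewrite /interp H slope_last mul0r subr0.
elim: m => [|m IH].
  by rewrite !big_ord0 /node mul0r min_r// mulr0 subrr.
by rewrite !big_ord_recr/= IH /kink; ring.
Qed.

Lemma node_bracket (p : R) : 0 <= p <= 1 ->
  exists2 k, (k <= N)%N & node k <= p <= node k.+1.
Proof.
move=> /andP[p0 p1].
suff H m : (m <= N)%N -> p <= node m.+1 ->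
  exists2 k, (k <= m)%N & node k <= p <= node k.+1.
  by apply: H => //; rewrite node_last.
elim: m => [|m IH] mN pm; first by exists 0%N => //; rewrite pm /node mul0r p0.
have [pm'|pm'] := leP p (node m.+1).
  by have [k km kp] := IH (ltnW mN) pm'; exists k => //; exact: leqW.
by exists m.+1 => //; rewrite pm ltW.
Qed.

Lemma interpE (p : R) k : (k <= N)%N -> node k <= p <= node k.+1 ->
  interp p = g (node k) + slope k * (p - node k).
Proof.
move=> kN /andP[kp pk].
have p01 : 0 <= p <= 1.
  by rewrite (le_trans (node_ge0 k) kp) (le_trans pk)// node_le1.
rewrite interp_abel//.
(* Slopes telescope up to the node [k]; intervals beyond [k.+1] contribute 0. *)
have below j : (j <= k)%N ->
    \sum_(i < j) slope i * (Num.min p (node i.+1) - Num.min p (node i)) = g (node j).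
  elim: j => [|j IH] jk; first by rewrite big_ord0 /node mul0r concave_distortion0.
  rewrite big_ord_recr/= IH ?(ltnW jk)//.
  have jp : node j.+1 <= p by rewrite (le_trans _ kp)// le_node.
  have jp' : node j <= p by rewrite (le_trans _ kp)// le_node// ltnW.
  have j1 : node j.+1 <= 1 by rewrite node_le1// (leq_trans jk)// leqW.
  have j0 : node j <= 1 by rewrite (le_trans _ j1)// le_node.
  rewrite (min_r jp) (min_r jp') /slope (min_l j1) (min_l j0) {2}nodeS.
  by field; rewrite gt_eqF.
have above j : (k < j)%N ->
    \sum_(i < j) slope i * (Num.min p (node i.+1) - Num.min p (node i)) =
    g (node k) + slope k * (p - node k).
  elim: j => [//|j IH]; rewrite ltnS leq_eqVlt big_ord_recr/= => /predU1P[<-|kj].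
    by rewrite below// (min_l pk) (min_r kp).
  rewrite IH//.
  have jp : p <= node j by rewrite (le_trans pk)// le_node.
  have jp' : p <= node j.+1 by rewrite (le_trans pk)// le_node// ltnW.
  by rewrite (min_l jp) (min_l jp') subrr mulr0 addr0.
exact: above.
Qed.

Lemma interp_chord (p : R) k : (k <= N)%N -> node k <= p <= node k.+1 ->
  interp p = N.+1%:R * ((node k.+1 - p) * g (node k) + (p - node k) * g (node k.+1)).
Proof.
move=> kN kp; rewrite (interpE kN kp) /slope !min_l ?node_le1 ?(leqW kN)//.
by rewrite nodeS; field; rewrite gt_eqF.
Qed.

Lemma interp_le (p : R) : 0 <= p <= 1 -> interp p <= g p.
Proof.
move=> p01; have [k kN kp] := node_bracket p01.
rewrite (interp_chord kN kp); have /andP[kp1 kp2] := kp.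
have := concave_distortion_chord (node_ge0 k) kp1 kp2 (node_le1 (kN : (k.+1 <= N.+1)%N)).
rewrite [X in _ <= (X - _) * _]nodeS addrAC subrr add0r.
by rewrite -(ler_pM2l n0) mulrA mulfV ?gt_eqF// mul1r.
Qed.

Lemma interp_ge_id (p : R) : 0 <= p <= 1 -> p <= interp p.
Proof.
move=> p01; have [k kN kp] := node_bracket p01.
rewrite (interp_chord kN kp); have /andP[kp1 kp2] := kp.
have gk : node k <= g (node k).
  by apply: concave_distortion_ge_id; rewrite node_ge0 node_le1// leqW.
have gk1 : node k.+1 <= g (node k.+1).
  by apply: concave_distortion_ge_id; rewrite node_ge0 node_le1.
rewrite (@le_trans _ _ (N.+1%:R *
  ((node k.+1 - p) * node k + (p - node k) * node k.+1)))//.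
  by rewrite nodeS le_eqVlt; apply/orP; left; apply/eqP; field; rewrite gt_eqF.
by rewrite ler_pM2l// lerD// ler_wpM2l// subr_ge0.
Qed.

(** On the way to [p] from the node on its left, a concave function vanishing at
    0 grows at most by the factor [p / x], and [x >= p - 1 / N.+1]. This
    replaces a continuity argument for [g]. *)
Lemma interp_ge (p : R) : 0 < p <= 1 -> g p - g p / p / N.+1%:R <= interp p.
Proof.
move=> /andP[p0 p1]; have p01 : 0 <= p <= 1 by rewrite ltW.
have [k kN kp] := node_bracket p01.
have /andP[kp1 kp2] := kp.
have k1 : node k <= 1 by rewrite node_le1// leqW.
apply: (@le_trans _ _ (g (node k))); last first.
  rewrite (interpE kN kp) lerDl mulr_ge0 ?subr_ge0// mulr_ge0// subr_ge0.
  have k2 : node k.+1 <= 1 by exact: node_le1.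
  rewrite (min_l k1) (min_l k2) concave_distortion_mono ?node_ge0//.
  exact: le_node.
have := concave_distortion_chord (lexx 0) (node_ge0 k) kp1 p1.
rewrite concave_distortion0 mulr0 add0r !subr0 => H.
have gp0 : 0 <= g p by rewrite (le_trans _ (concave_distortion_ge_id p01))// ltW.
rewrite -(ler_pM2l p0) (le_trans _ H)//.
have -> : p * (g p - g p / p / N.+1%:R) = (p - N.+1%:R^-1) * g p.
  by field; rewrite !gt_eqF.
by rewrite ler_wpM2r// lerBlDr -nodeS.
Qed.

End concave_interpolation.

Lemma cvg_interp (R : realType) (g : R -> R) (p : R) : concave_distortion g ->
  0 <= p <= 1 -> interp g N p @[N --> \oo] --> g p.
Proof.
move=> hg p01; have [p0|p0] := eqVneq p 0.
  have -> : (fun N => interp g N p) = fun=> g p.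
    apply/funext => N; apply/eqP; rewrite eq_le interp_le//= p0 concave_distortion0//.
    by apply: interp_ge_id; rewrite // lexx ler01.
  exact: cvg_cst.
have {}p0 : 0 < p <= 1 by move: p01 => /andP[p0' ->]; rewrite lt_neqAle eq_sym p0 p0'.
apply: (@squeeze_cvgr _ _ _ _ (fun N => g p - g p / p * harmonic N) (fun=> g p)).
- by apply: nearW => N; rewrite interp_ge//= interp_le.
- rewrite -[X in _ --> X]subr0; apply: cvgB; first exact: cvg_cst.
  rewrite -[X in _ --> X](mulr0 (g p / p)); apply: cvgM; first exact: cvg_cst.
  exact: cvg_harmonic.
- exact: cvg_cst.
Qed.

(** * Subadditivity for a concave distortion *)

Section concave_subadditivity.
Context (dT : measure_display) (T : measurableType dT) (R : realType).
Context (P : probability T R).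
Implicit Types (X Y Z : {RV P >-> R}) (g : R -> R).
Local Notation leb := (@lebesgue_measure R).

Lemma measurable_concave_distortion g Y : concave_distortion g ->
  measurable_fun [set: R] (g \o tail Y).
Proof.
move=> hg; apply: nonincreasing_measurable => // s t st /=.
by apply: concave_distortion_mono;
  rewrite ?tail_ge0 ?tail_le1 ?tail_nonincreasing.
Qed.

Lemma choquet_sum_cap (w s : nat -> R) n Y :
  (forall i, (i < n)%N -> 0 < s i <= 1) -> P.-integrable [set: T] (EFin \o Y) ->
  let f p := \sum_(i < n) w i * cap (s i) p in
  layer_integrable f Y /\
  choquet f Y = \sum_(i < n) w i * choquet (cap (s i)) Y.
Proof.
move=> s01 iY; elim: n s01 => [|n IH] s01 /=.
  have E : layer (fun p => \sum_(i < 0) w i * cap (s i) p) Y = cst 0.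
    by apply/funext => t; rewrite /layer !big_ord0 mul0r subrr.
  rewrite /layer_integrable /choquet E big_ord0; split; first exact: integrable0.
  by rewrite Rintegral_cst// mul0r.
have [iF IF] := IH (fun i iN => s01 i (leqW iN)).
have [iG IG] := choquetZ (w n) (layer_integrable_cap (s01 n (ltnSn n)) iY).
have [iFG IFG] := choquetD iF iG.
have E : (fun p => \sum_(i < n.+1) w i * cap (s i) p) =
    (fun p => \sum_(i < n) w i * cap (s i) p) \+ (w n \*o cap (s n)).
  by apply/funext => p; rewrite big_ord_recr.
by rewrite E big_ord_recr/= -IG -IF; split.
Qed.

Lemma choquet_interp g N Y : P.-integrable [set: T] (EFin \o Y) ->
  layer_integrable (interp g N) Y /\
  choquet (interp g N) Y =
    \sum_(i < N.+1) kink g N i * choquet (cap (node R N i.+1)) Y.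
Proof.
move=> iY; apply: (@choquet_sum_cap (kink g N) (fun i => node R N i.+1)) => // i iN.
by rewrite node_gt0 node_le1.
Qed.

Lemma interp1 g N : concave_distortion g -> interp g N 1 = 1.
Proof.
move=> hg; have I1 : 0 <= (1 : R) <= 1 by rewrite ler01 lexx.
apply/eqP; rewrite eq_le (interp_ge_id hg)// andbT.
by rewrite (le_trans (interp_le hg _ I1))// concave_distortion1.
Qed.

Lemma choquet_interp_le g N Y : concave_distortion g ->
  P.-integrable [set: T] (EFin \o Y) -> layer_integrable g Y ->
  choquet (interp g N) Y <= choquet g Y.
Proof.
move=> hg iY ig; apply: le_choquet => //.
- by rewrite interp1// concave_distortion1.
- by move=> p p01; exact: interp_le.
- exact: (choquet_interp g N iY).1.
Qed.

(** The interpolations lie between the identity and [g], so their layers are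
    dominated by the layers of these two. *)
Lemma cvg_choquet_interp g Y : concave_distortion g ->
  P.-integrable [set: T] (EFin \o Y) -> layer_integrable g Y ->
  choquet (interp g N) Y @[N --> \oo] --> choquet g Y.
Proof.
move=> hg iY ig.
have tl01 t : 0 <= tail Y t <= 1 by rewrite tail_ge0 tail_le1.
have [iid _] := expectation_choquet iY.
have iN N := (choquet_interp g N iY).1.
have ib : leb.-integrable [set: R]
    (EFin \o (fun t => `|layer id Y t| + `|layer g Y t|)).
  exact: (integrableD _ (integrable_norm iid) (integrable_norm ig)).
have [] := @dominated_convergence _ _ _ leb [set: R] measurableT
  (fun N => EFin \o layer (interp g N) Y) (EFin \o layer g Y) _
  (fun N => measurable_int _ (iN N)) (measurable_int _ ig) _ ib _.
- apply: aeW => t _; apply: cvg_EFin; first exact: nearW.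
  apply: cvgB; first by apply: cvg_interp.
  under eq_fun do rewrite interp1//.
  by rewrite concave_distortion1//; exact: cvg_cst.
- apply: aeW => t N _ /=; rewrite lee_fin.
  have l1 : layer id Y t <= layer (interp g N) Y t.
    by rewrite /layer interp1// lerD2r interp_ge_id.
  have l2 : layer (interp g N) Y t <= layer g Y t.
    by rewrite /layer interp1// concave_distortion1// lerD2r interp_le.
  rewrite ler_norml; apply/andP; split.
    rewrite (le_trans _ l1)// lerNl.
    have := ler_norm (- layer id Y t); rewrite normrN.
    by have := normr_ge0 (layer g Y t); lra.
  by have := ler_norm (layer g Y t); have := normr_ge0 (layer id Y t); lra.
move=> _ _ H; apply: fine_cvg; move: H.
by rewrite /choquet /Rintegral fineK//; exact: integrable_fin_num.
Qed.

(** The interpolations bound [g] from below, so the limit is needed for [X]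
    only. *)
Theorem choquet_subadditive g X Z1 Z2 : concave_distortion g ->
  P.-integrable [set: T] (EFin \o X) ->
  P.-integrable [set: T] (EFin \o Z1) -> P.-integrable [set: T] (EFin \o Z2) ->
  layer_integrable g X -> layer_integrable g Z1 -> layer_integrable g Z2 ->
  {ae P, forall w, Z1 w + Z2 w = X w} ->
  choquet g X <= choquet g Z1 + choquet g Z2.
Proof.
move=> hg iX i1 i2 gX gi1 gi2 ZX.
apply: (cvgr_to_le (cvg_choquet_interp hg iX gX)); apply: nearW => N.
apply: (@le_trans _ _ (choquet (interp g N) Z1 + choquet (interp g N) Z2)).
  rewrite (choquet_interp g N iX).2 (choquet_interp g N i1).2 (choquet_interp g N i2).2.
  rewrite -big_split/=; apply: ler_sum => i _; rewrite -mulrDr.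
  have iN : (i <= N)%N by rewrite -ltnS.
  rewrite ler_wpM2l ?kink_ge0// choquet_cap_subadditive//.
  by rewrite node_gt0 node_le1.
by rewrite lerD// choquet_interp_le.
Qed.

End concave_subadditivity.

(** * Loaded power distortions and their envelope *)

Section power_distortions.
Context (R : realType).

(** A concave function on [0, 1] that is largest at 1 is nondecreasing, and it
    lies above its chord, hence is nonnegative. *)
Lemma concave_distortion_intro (g : R -> R) : g 0 = 0 -> g 1 = 1 ->
  (forall x : R, 0 <= x <= 1 -> g x <= 1) ->
  (forall t x z : R, 0 <= t -> t <= 1 -> 0 <= x <= 1 -> 0 <= z <= 1 ->
    t * g x + (1 - t) * g z <= g (t * x + (1 - t) * z)) ->
  concave_distortion g.
Proof.
move=> g0 g1 gle1 gconv; split => //.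
- move=> x; rewrite !in_itv/= => x01; rewrite gle1// andbT.
  have /andP[x0 x1] := x01; rewrite (le_trans x0)//.
  have := @gconv x 1 0 x0 x1; rewrite ler01 !lexx/= => /(_ isT isT).
  by rewrite g0 g1 !mulr0 !mulr1 !addr0.
- move=> x y; rewrite !in_itv/= => /andP[x0 x1] /andP[y0 y1] xy.
  have [x1'|x1'] := eqVneq x 1.
    by have -> : y = x by apply/eqP; rewrite eq_le xy x1' y1.
  have {x1'}x1' : 0 < 1 - x by rewrite subr_gt0 lt_neqAle x1' x1.
  have t0 : 0 <= (1 - y) / (1 - x) by rewrite divr_ge0 ?subr_ge0.
  have t1 : (1 - y) / (1 - x) <= 1 by rewrite ler_pdivrMr// mul1r lerD2l lerN2.
  have := @gconv _ x 1 t0 t1; rewrite x0 x1 ler01 lexx/= => /(_ isT isT).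
  have -> : (1 - y) / (1 - x) * x + (1 - (1 - y) / (1 - x)) * 1 = y.
    by field; rewrite gt_eqF.
  apply: le_trans; rewrite g1 mulr1.
  have := gle1 x; rewrite x0 x1 => /(_ isT) gx1.
  have : 0 <= (1 - (1 - y) / (1 - x)) * (1 - g x).
    by rewrite mulr_ge0// subr_ge0.
  by lra.
- move=> t x z /[!inE]/= /[!in_itv]/= x01 z01.
  have t0 : 0 <= t%:num :> R by [].
  have t1 : t%:num <= 1 :> R by [].
  have := gconv _ x z t0 t1 x01 z01.
  by rewrite convRE/= /unstable.onem !mulrN -opprD lerN2.
Qed.

Lemma powR_conv (r t x z : R) : 1 <= r -> 0 <= t -> t <= 1 -> 0 <= x -> 0 <= z ->
  (t * x + (1 - t) * z) `^ r <= t * x `^ r + (1 - t) * z `^ r.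
Proof.
move=> r1 t0 t1 x0 z0.
have mem0 (u : R) : 0 <= u -> u \in (`[0, +oo[%classic : set R).
  by move=> u0; rewrite inE/= in_itv/= u0.
have := convex_powR r1 (Itv01 t0 t1) (mem0 _ x0) (mem0 _ z0).
by rewrite conv_real.
Qed.

Variables (a c1 c2 : R).

(** The insurer's distortion after the premium has been charged to it; it can
    exceed 1, and it can decrease near 1. *)
Definition loaded (p : R) : R := a * p `^ c1 - (a - 1) * p.

Definition envelope (p : R) : R := Num.min (loaded p) (p `^ c2).

Lemma loaded0 : 0 < c1 -> loaded 0 = 0.
Proof. by move=> c10; rewrite /loaded powR0 ?gt_eqF// !mulr0 subrr. Qed.

Lemma loaded1 : loaded 1 = 1.
Proof. by rewrite /loaded powR1 !mulr1; ring. Qed.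

Lemma envelope1 : envelope 1 = 1.
Proof. by rewrite /envelope loaded1 powR1 minxx. Qed.

Hypotheses (a1 : 1 < a) (c20 : 0 < c2) (c21 : c2 < c1) (c11 : c1 < 1).

Let c10 : 0 < c1. Proof. exact: lt_trans c21. Qed.
Let c2lt1 : c2 < 1. Proof. exact: lt_trans c11. Qed.

Lemma concave_distortion_envelope : concave_distortion envelope.
Proof.
have d1 : concave_distortion (fun p : R => p `^ c1).
  by apply: powR_concave_distortion; rewrite c10.
have d2 : concave_distortion (fun p : R => p `^ c2).
  by apply: powR_concave_distortion; rewrite c20.
apply: concave_distortion_intro.
- by rewrite /envelope loaded0// powR0 ?gt_eqF// minxx.
- exact: envelope1.
- move=> x x01; rewrite ge_min; apply/orP; right.
  case: d2 => + _ _ _ _ => /(_ x); rewrite !in_itv/= => /(_ x01).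
  by move=> /andP[].
move=> t x z t0 t1 x01 z01.
have e1 := concave_distortion_conv d1 t0 t1 x01 z01.
have e2 := concave_distortion_conv d2 t0 t1 x01 z01.
have le1 p : envelope p <= loaded p by rewrite ge_min lexx.
have le2 p : envelope p <= p `^ c2 by rewrite ge_min lexx orbT.
have s0 : 0 <= 1 - t by rewrite subr_ge0.
rewrite [leRHS]/envelope le_min; apply/andP; split.
  apply: (@le_trans _ _ (t * loaded x + (1 - t) * loaded z)).
    by rewrite lerD// ler_wpM2l.
  have a0 : 0 <= a by rewrite (le_trans ler01)// ltW.
  by move: (ler_wpM2l a0 e1); rewrite /loaded; lra.
by rewrite (le_trans _ e2)// lerD// ler_wpM2l.
Qed.

(** The function [u |-> a u - (a - 1) u ^ r - 1] is concave and vanishes at 1, so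
    on [u, 1] it lies above a chord from a positive value to 0. *)
Lemma power_gap_ge0 (r u v : R) : 1 <= r -> 0 <= u -> u <= v -> v <= 1 ->
  0 < a * u - (a - 1) * u `^ r - 1 -> 0 <= a * v - (a - 1) * v `^ r - 1.
Proof.
move=> r1 u0 uv v1 psiq.
have u1 : 0 < 1 - u.
  rewrite subr_gt0 lt_neqAle (le_trans uv v1) andbT; apply/eqP => u1.
  by move: psiq; rewrite u1 powR1 !mulr1 opprB addrCA subrr addr0 subrr ltxx.
pose t := (1 - v) / (1 - u).
have t0 : 0 <= t by rewrite divr_ge0 ?subr_ge0// ltW// -subr_gt0.
have t1 : t <= 1 by rewrite ler_pdivrMr// mul1r lerD2l lerN2.
(* [v] between [u] and 1 as a convex combination. *)
have vE : t * u + (1 - t) * 1 = v by rewrite /t; field; rewrite gt_eqF.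
have := powR_conv r1 t0 t1 u0 ler01; rewrite vE powR1 mulr1 => cvx.
have am0 : 0 <= a - 1 by rewrite subr_ge0 ltW.
clearbody t.
have tpsi : t * (a * u - (a - 1) * u `^ r - 1) =
    a * v - (a - 1) * (t * u `^ r + (1 - t)) - 1.
  by rewrite -{1}vE; ring.
have := mulr_ge0 t0 (ltW psiq); rewrite tpsi => /le_trans; apply.
by rewrite lerD2r lerD2l lerN2 ler_wpM2l.
Qed.

(** With [u = p ^ (c1 - c2)] and [r = (1 - c2) / (c1 - c2) >= 1], the difference
    [loaded p - p ^ c2] is [p ^ c2] times the concave function of
    [power_gap_ge0]. *)
Lemma loaded_lt_power_down (p q : R) : 0 < q -> q <= p -> p <= 1 ->
  loaded p < p `^ c2 -> loaded q <= q `^ c2.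
Proof.
move=> q0 qp p1 pneg; rewrite leNgt; apply/negP => qpos.
have p0 : 0 < p := lt_le_trans q0 qp.
pose al := c1 - c2; pose r := (1 - c2) / al.
have al0 : 0 < al by rewrite subr_gt0.
have r1 : 1 <= r by rewrite /r ler_pdivlMr// mul1r lerD2r ltW.
pose psi u := a * u - (a - 1) * u `^ r - 1.
have loadedE x : 0 < x -> loaded x - x `^ c2 = x `^ c2 * psi (x `^ al).
  move=> x0; have xn0 : (x == 0) = false by rewrite gt_eqF.
  have e1 : x `^ c1 = x `^ c2 * x `^ al.
    by rewrite -powRD ?xn0 ?implybT// /al addrC subrK.
  have e2 : x = x `^ c2 * (x `^ al) `^ r.
    rewrite -powRrM /r [al * _]mulrC divfK ?gt_eqF// -powRD ?xn0 ?implybT//.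
    by rewrite addrC subrK powRr1// ltW.
  by rewrite /loaded {2}e2 e1 /psi; ring.
have psip : psi (p `^ al) < 0.
  by rewrite -(pmulr_rlt0 _ (powR_gt0 c2 p0)) -loadedE// subr_lt0.
have psiq : 0 < psi (q `^ al).
  by rewrite -(pmulr_rgt0 _ (powR_gt0 c2 q0)) -loadedE// subr_gt0.
set u := q `^ al in psiq; set v := p `^ al in psip.
have u0 : 0 <= u by exact: powR_ge0.
have uv : u <= v by rewrite ge0_ler_powR ?nnegrE ?(ltW al0) ?(ltW p0) ?(ltW q0).
have v1 : v <= 1.
  have <- : 1 `^ al = 1 by rewrite powR1.
  by rewrite ge0_ler_powR ?nnegrE ?ler01 ?(ltW al0) ?(ltW p0).
move: psip; apply/negP; rewrite -leNgt.
exact: (power_gap_ge0 r1 u0 uv v1 psiq).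
Qed.

(** This makes the deductible finite: far out in the tail the insurer always
    has the smaller distortion. *)
Lemma loaded_le_power_near0 :
  exists2 e : R, 0 < e & forall p, 0 < p < e -> loaded p < p `^ c2.
Proof.
have a0 : 0 < a by rewrite (lt_trans ltr01).
have al0 : 0 < c1 - c2 by rewrite subr_gt0.
exists (a^-1 `^ (c1 - c2)^-1); first by apply: powR_gt0; rewrite invr_gt0.
move=> p /andP[p0 pe]; rewrite /loaded ltrBlDr.
have xn0 : (p == 0) = false by rewrite gt_eqF.
have -> : p `^ c1 = p `^ c2 * p `^ (c1 - c2).
  by rewrite -powRD ?xn0 ?implybT// addrC subrK.
have : p `^ (c1 - c2) < a^-1.
  have <- : (a^-1 `^ (c1 - c2)^-1) `^ (c1 - c2) = a^-1.
    by rewrite -powRrM mulVf ?gt_eqF// powRr1// invr_ge0 ltW.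
  by rewrite gt0_ltr_powR ?nnegrE ?powR_ge0 ?(ltW p0).
move=> pa; have h : a * p `^ (c1 - c2) < 1.
  by rewrite mulrC -ltr_pdivlMr// mul1r.
rewrite mulrCA (@lt_le_trans _ _ (p `^ c2 * 1))//.
  by rewrite ltr_pM2l ?powR_gt0.
by rewrite mulr1 lerDl mulr_ge0 ?(ltW p0)// subr_ge0 ltW.
Qed.

End power_distortions.

(** * Translation of integrals, finiteness of preferences *)

Section translation.
Context (R : realType).
Local Notation leb := (@lebesgue_measure R).

Definition translate (d : R) : measurableTypeR R -> measurableTypeR R :=
  fun t => t - d.

Lemma measurable_translate d : measurable_fun [set: measurableTypeR R] (translate d).
Proof. exact: measurable_funB. Qed.

HB.instance Definition _ d := isMeasurableFun.Build _ _ _ _ (translate d)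
  (measurable_translate d).

Lemma lebesgue_measure_translate (d : R) (A : set R) : measurable A ->
  pushforward leb (translate d) A = leb A.
Proof.
move=> mA; apply/esym/lebesgue_measure_unique => //= _ [[a b]] _ <-.
rewrite /pushforward/= (_ : _ @^-1` _ = `]a + d, b + d]%classic).
  rewrite !lebesgue_measure_itv/= !lte_fin ltrD2r -!EFinB.
  by rewrite [b + d]addrC [a + d]addrC opprD addrACA subrr add0r.
by apply/seteqP; split=> t /=; rewrite !in_itv/= /translate ltrBrDr lerBlDr.
Qed.

Lemma Rintegral_translate (d : R) (f : R -> R) :
  leb.-integrable [set: R] (EFin \o f) ->
  leb.-integrable [set: R] (EFin \o (f \o translate d)) /\
  Rintegral leb [set: R] (f \o translate d) = Rintegral leb [set: R] f.
Proof.
move=> fi; have /integrableP[mf foo] := fi.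
have md := measurable_translate d.
have i' : leb.-integrable [set: R] (EFin \o (f \o translate d)).
  apply/integrableP; split; first exact: (measurableT_comp mf md).
  move: foo; congr (_ < _)%E.
  transitivity (\int[pushforward leb (translate d)]_x `|(EFin \o f) x|)%E.
    by apply: eq_measure_integral => A mA _; exact/esym/lebesgue_measure_translate.
  rewrite (ge0_integral_pushforward md)//.
  exact: measurableT_comp.
split=> //; rewrite /Rintegral; congr fine.
transitivity (\int[pushforward leb (translate d)]_x ((EFin \o f) x))%E.
  by rewrite (integral_pushforward md).
by apply: eq_measure_integral => A mA _; exact: lebesgue_measure_translate.
Qed.

End translation.

Section preferences.
Context (dT : measure_display) (T : measurableType dT) (R : realType).
Context (P : probability T R).
Implicit Types (X Y Z : {RV P >-> R}) (g : R -> R).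

Lemma expectation_fin_numE Y :
  ('E_P[Y] \is a fin_num)%E = `[< P.-integrable [set: T] (EFin \o Y) >].
Proof.
rewrite expectation_def -integral_fin_num_abs//.
apply/idP/asboolP => [h|/integrableP[]//].
by apply/integrableP; split=> //; apply/measurable_EFinP.
Qed.

Lemma fin_num_Zl (k : R) (x : \bar R) : k != 0 ->
  (k%:E * x)%E \is a fin_num = (x \is a fin_num).
Proof.
move=> k0; case: x => [x||]//.
  by rewrite mulry; case: sgrP k0 => //; rewrite ?mul1e ?mulN1e.
by rewrite mulrNy; case: sgrP k0 => //; rewrite ?mul1e ?mulN1e.
Qed.

(** Common to both parties: [k] is [1 + b1] for the insurer and 1 for the buyer,
    [l] is [1 + theta]. *)
Lemma preferenceE (k l c : R) g Y : 0 < k -> 0 < l -> 0 < c ->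
  (forall p, 0 <= p <= 1 -> g p = p `^ c) ->
  let V := (k%:E * distortion_risk g Y - l%:E * 'E_P[Y])%E in
  (V \is a fin_num <-> P.-integrable [set: T] (EFin \o Y) /\
     layer_integrable (@powR R ^~ c) Y) /\
  (V \is a fin_num ->
     V = (k * choquet (@powR R ^~ c) Y - l * choquet id Y)%:E).
Proof.
move=> k0 l0 c0 gE.
have -> : distortion_risk g Y = distortion_risk (@powR R ^~ c) Y.
  by rewrite /distortion_risk; congr (_ + _)%E; apply: eq_integral => t _;
    rewrite gE// -/(tail Y t) tail_ge0 tail_le1.
have mc : measurable_fun [set: R] ((@powR R ^~ c) \o tail Y).
  by apply: measurableT_comp (measurable_tail Y); exact: measurable_powR.
have p1 : (@powR R ^~ c) 1 = 1 by rewrite powR1.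
have [iff VE] := distortion_risk_layer p1 mc.
move=> V.
have fE : V \is a fin_num <-> P.-integrable [set: T] (EFin \o Y) /\
     layer_integrable (@powR R ^~ c) Y.
  rewrite /V fin_numB !fin_num_Zl ?gt_eqF// expectation_fin_numE.
  split=> [/andP[/iff h /asboolP]|[h /iff ->]]; first by [].
  by apply/asboolP.
split=> // /fE[iY iL]; rewrite /V (VE iL).
by rewrite (expectation_choquet iY).2.
Qed.

End preferences.

(** * Layers of a deductible contract *)

Section deductible_layers.
Context (dT : measure_display) (T : measurableType dT) (R : realType).
Context (P : probability T R) (X : {RV P >-> R}).
Hypothesis X0 : {ae P, forall w, 0 <= X w}.
Local Notation leb := (@lebesgue_measure R).

Lemma tail_neg t : t < 0 -> tail X t = 1.
Proof. by move=> t0; apply: tail_eq1; apply: filterS X0 => w; exact: lt_le_trans. Qed.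

(** A variable that is almost surely nonnegative agrees almost surely with its
    positive part, whose expectation is the integral of the tail. *)
Lemma integrable_of_layer : layer_integrable id X ->
  P.-integrable [set: T] (EFin \o X).
Proof.
move=> /integrableP[ml loo].
pose Xp : {RV P >-> R} := X \max cst 0.
have Xp0 w : 0 <= Xp w by rewrite le_max lexx orbT.
have EXp : ('E_P[Xp] < +oo)%E.
  rewrite ge0_expectation_ccdf//; apply: le_lt_trans loo.
  apply: (@le_trans _ _ (\int[leb]_(t in `[0%R, +oo[) `|(EFin \o layer id X) t|)%E).
    rewrite le_eqVlt; apply/orP; left; apply/eqP; apply: eq_integral.
    move=> t; rewrite inE/= in_itv/= andbT => t0.
    by rewrite layer_pos// ccdf_tail tail_max ltNge t0/= ger0_norm// tail_ge0.
  by apply: ge0_subset_integral => //; exact: measurableT_comp.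
apply/integrableP; split; first exact/measurable_EFinP.
rewrite (ae_eq_integral (fun w => (Xp w)%:E)).
- by move: EXp; rewrite expectation_def.
- by [].
- by apply: measurableT_comp => //; exact/measurable_EFinP.
- exact/measurable_EFinP.
- by apply: filterS X0 => w w0 _ /=; rewrite ger0_norm// max_l.
Qed.

Lemma layer_integrable_dominated (c : R) (Y : {RV P >-> R}) : 0 < c ->
  (forall t, t < 0 -> tail Y t = 1) -> (forall t, tail Y t <= tail X t) ->
  layer_integrable (@powR R ^~ c) X -> layer_integrable (@powR R ^~ c) Y.
Proof.
move=> c0 Yn YX iX; rewrite /layer_integrable; apply: (le_integrable _ _ _ iX) => //.
  apply/measurable_EFinP; apply: measurable_layer.
  by apply: measurableT_comp (measurable_tail Y); exact: measurable_powR.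
move=> t _ /=; rewrite lee_fin; have [t0|t0] := ltP t 0.
  by rewrite layer_neg// Yn// subrr normr0.
rewrite !layer_pos// !ger0_norm ?powR_ge0//.
by rewrite ge0_ler_powR ?nnegrE ?tail_ge0// ltW.
Qed.

Lemma layer_integrable_id (c : R) : 0 < c -> c <= 1 ->
  layer_integrable (@powR R ^~ c) X -> layer_integrable id X.
Proof.
move=> c0 cle1 iX; rewrite /layer_integrable; apply: (le_integrable _ _ _ iX) => //.
  by apply/measurable_EFinP; apply: measurable_layer; exact: measurable_tail.
move=> t _ /=; rewrite lee_fin; have [t0|t0] := ltP t 0.
  by rewrite layer_neg// tail_neg// subrr normr0.
rewrite !layer_pos// !ger0_norm ?powR_ge0 ?tail_ge0//=.
have [->|p0] := eqVneq (tail X t) 0; first exact: powR_ge0.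
rewrite -{1}(powRr1 (tail_ge0 X t)) ger_powR// tail_le1 andbT.
by rewrite lt_neqAle eq_sym p0 tail_ge0.
Qed.

Variables (a c1 c2 : R).
Hypotheses (a1 : 1 < a) (c20 : 0 < c2) (c21 : c2 < c1) (c11 : c1 < 1).

(** The heights at which the insurer has the smaller distortion form an up-set,
    because the tail decreases and, by the single crossing, smallness of the
    insurer's distortion is inherited by smaller probabilities. The deductible
    is the infimum of this up-set. *)
Lemma exists_deductible : exists2 d : R, 0 <= d &
  (forall t, t < d -> tail X t `^ c2 <= loaded a c1 (tail X t)) /\
  (forall t, d < t -> loaded a c1 (tail X t) <= tail X t `^ c2).
Proof.
have c10 : 0 < c1 := lt_trans c20 c21.
(* The clause on vanishing tails keeps [D] upward closed: at 0 the two
   distortions agree, so strict inequality is lost there. *)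
pose D := [set t | 0 <= t /\ (tail X t = 0 \/ loaded a c1 (tail X t) < tail X t `^ c2)].
have [u uD] : D !=set0.
  have [e e0 He] := loaded_le_power_near0 a1 c21.
  have [//|nD] := pselect (D !=set0); exfalso.
  have : (e%:E <= 0 :> \bar R)%E.
    apply: (cvge_ge _ (cvg_ccdfy0 X)); near=> t.
    rewrite ccdf_tail lee_fin leNgt; apply/negP => te; apply: nD; exists t.
    split; first by near: t; exact: nbhs_pinfty_ge.
    have [|p0] := eqVneq (tail X t) 0; [by left|right].
    by apply: He; rewrite te lt_neqAle eq_sym p0 tail_ge0.
  by rewrite lee_fin leNgt e0.
have D0 : lbound D 0 by move=> t [].
have hD : has_lbound D by exists 0.
exists (inf D); first apply: lb_le_inf (ex_intro _ u uD) D0.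
split=> t tD.
  have [t0|t0] := ltP t 0.
    by rewrite tail_neg// loaded1 powR1.
  rewrite leNgt; apply/negP => neg.
  have /(ge_inf hD) : D t by split=> //; right.
  by rewrite leNgt tD.
have [v [v0 Dv] vt] := inf_lt (ex_intro _ u uD) tD.
have tv := tail_nonincreasing X (ltW vt).
have [->|p0] := eqVneq (tail X t) 0; first by rewrite loaded0// powR_ge0.
have {}p0 : 0 < tail X t by rewrite lt_neqAle eq_sym p0 tail_ge0.
case: Dv => [v0'|neg]; first by move: tv; rewrite v0' leNgt p0.
exact: (loaded_lt_power_down a1 c21 c11 p0 tv (tail_le1 _ _) neg).
Unshelve. all: by end_near. Qed.

Variable d : R.
Hypothesis d0 : 0 <= d.
Let Y1 : {RV P >-> R} := deductible d%:E \o X.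
Let Y2 : {RV P >-> R} := X \- Y1.

Lemma tail_covered t : tail Y1 t = if t < 0 then 1 else tail X (t + d).
Proof.
case: ltP => t0.
  by apply: tail_eq1; apply: aeW => w /=; rewrite lt_max t0 orbT.
by apply: tail_eq; apply: aeW => w /=; rewrite lt_max [t < 0]ltNge t0 orbF ltrBrDr.
Qed.

Lemma tail_covered_le t : tail Y1 t <= tail X t.
Proof.
rewrite tail_covered; case: ltP => t0; first by rewrite tail_neg.
by apply: tail_nonincreasing; rewrite lerDl.
Qed.

Lemma tail_retained t : tail Y2 t = if t < d then tail X t else 0.
Proof.
case: ltP => td; last first.
  apply: tail_eq0 => w /=; rewrite /deductible.
  by rewrite lerBlDr -lerBlDl le_max lerD2l lerN2 td.
apply: tail_eq; apply: aeW => w /=.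
rewrite /deductible; have [xd|xd] := ltP (X w - d) 0.
  by rewrite subr0.
rewrite subKr td; apply/esym; apply: lt_le_trans td _.
by rewrite -subr_ge0.
Qed.

Lemma tail_retained_le t : tail Y2 t <= tail X t.
Proof. by rewrite tail_retained; case: ifP => // _; exact: tail_ge0. Qed.

Lemma integrable_covered : P.-integrable [set: T] (EFin \o X) ->
  P.-integrable [set: T] (EFin \o Y1).
Proof.
move=> iX; apply: (le_integrable _ _ _ iX) => //; first exact/measurable_EFinP.
move=> w _ /=; rewrite lee_fin ger0_norm ?le_max ?lexx ?orbT//.
rewrite ge_max normr_ge0 andbT (le_trans _ (ler_norm _))//.
by rewrite lerBlDr lerDl.
Qed.

(** After translating the covered share by [d], the two shares split the layers
    of [X] at height [d]. At [d] itself the cheaper party is not determined by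
    the hypotheses, hence an equality almost everywhere. *)
Lemma choquet_deductible : 
  (forall t, t < d -> tail X t `^ c2 <= loaded a c1 (tail X t)) ->
  (forall t, d < t -> loaded a c1 (tail X t) <= tail X t `^ c2) ->
  layer_integrable (loaded a c1) Y1 -> layer_integrable (@powR R ^~ c2) Y2 ->
  layer_integrable (envelope a c1 c2) X ->
  choquet (loaded a c1) Y1 + choquet (@powR R ^~ c2) Y2 = choquet (envelope a c1 c2) X.
Proof.
move=> below above i1 i2 iX.
have c10 : 0 < c1 := lt_trans c20 c21.
have [j1 I1] := Rintegral_translate d i1.
rewrite /choquet -I1 -RintegralD// /Rintegral; congr fine.
apply: ae_eq_integral => //.
- exact: measurable_int (integrableD _ j1 i2).
- exact: measurable_int iX.
exists [set d]; split=> //; first exact: lebesgue_measure_set1.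
move=> t /= /not_implyP[_]; apply: contra_notP => /eqP td.
rewrite /= /translate; congr EFin.
rewrite /layer tail_covered tail_retained subr_lt0 subrK loaded1 envelope1 powR1.
have [lt_td|lt_dt|/eqP] := ltgtP t d; last by rewrite (negbTE td).
  by rewrite loaded1 /envelope min_r ?below// !mul1r subrr add0r.
rewrite powR0 ?gt_eqF// ltNge (le_trans d0 (ltW lt_dt))/= !mulr0 !subr0 addr0.
by rewrite /envelope min_l// above.
Qed.

End deductible_layers.

(** * The cost of an allocation *)

Section social_cost.
Context (dT : measure_display) (T : measurableType dT) (R : realType).
Context (P : probability T R) (X : {RV P >-> R}).
Variables (a c1 c2 : R).
Hypotheses (a1 : 1 < a) (c20 : 0 < c2) (c21 : c2 < c1) (c11 : c1 < 1).
Implicit Types (Y Z : {RV P >-> R}).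

Let c10 : 0 < c1. Proof. exact: lt_trans c21. Qed.

Lemma measurable_powR_tail (c : R) Y : measurable_fun [set: R] ((@powR R ^~ c) \o tail Y).
Proof. by apply: measurableT_comp (measurable_tail Y); exact: measurable_powR. Qed.

Lemma ler_powR_exponent (c c' p : R) : 0 < c' -> c' <= c -> 0 <= p <= 1 ->
  p `^ c <= p `^ c'.
Proof.
move=> c0 cc /andP[p0 p1]; have [->|pn0] := eqVneq p 0.
  by rewrite !powR0 ?gt_eqF// (lt_le_trans c0).
by rewrite ger_powR// lt_neqAle eq_sym pn0 p0.
Qed.

Lemma layer_integrable_power (c c' : R) Y : 0 < c' -> c' <= c -> c <= 1 ->
  layer_integrable id Y ->
  layer_integrable (@powR R ^~ c') Y -> layer_integrable (@powR R ^~ c) Y.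
Proof.
move=> c0 cc c1' i1 i2; apply: (layer_integrable_between _ _ _ _ i1 i2).
- exact: measurable_powR_tail.
- by rewrite powR1.
- by rewrite !powR1.
- move=> p p01; have /andP[p0 _] := p01; rewrite ler_powR_exponent// andbT.
  by rewrite -{1}(powRr1 p0) ler_powR_exponent// (lt_le_trans c0).
Qed.

Lemma choquet_loaded Y : layer_integrable id Y ->
  layer_integrable (@powR R ^~ c1) Y ->
  layer_integrable (loaded a c1) Y /\
  choquet (loaded a c1) Y =
    a * choquet (@powR R ^~ c1) Y - (a - 1) * choquet id Y.
Proof.
move=> iid ic; have [i1 I1] := choquetZ a ic; have [i2 I2] := choquetZ (- (a - 1)) iid.
have [i3 I3] := choquetD i1 i2.
have E : loaded a c1 = (a \*o (@powR R ^~ c1)) \+ ((- (a - 1)) \*o id).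
  by apply/funext => p; rewrite /loaded /= mulNr.
by rewrite E; split=> //; rewrite I3 I1 I2 mulNr.
Qed.

Lemma layer_integrable_envelope g Y :
  (forall p, 0 <= p <= 1 -> envelope a c1 c2 p <= g p) ->
  g 1 = 1 -> layer_integrable id Y -> layer_integrable g Y ->
  layer_integrable (envelope a c1 c2) Y.
Proof.
move=> eg g1 iid ig; have he := concave_distortion_envelope a1 c20 c21 c11.
apply: (layer_integrable_between _ _ _ _ iid ig).
- exact: measurable_concave_distortion.
- by rewrite envelope1.
- by rewrite envelope1.
- by move=> p p01; rewrite eg// andbT concave_distortion_ge_id.
Qed.

(** Each share is charged less under the envelope than under the distortion of
    its holder, and the envelope is subadditive. *)
Lemma envelope_bound Z1 Z2 :
  P.-integrable [set: T] (EFin \o X) -> layer_integrable (@powR R ^~ c2) X ->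
  P.-integrable [set: T] (EFin \o Z1) -> layer_integrable (@powR R ^~ c1) Z1 ->
  P.-integrable [set: T] (EFin \o Z2) -> layer_integrable (@powR R ^~ c2) Z2 ->
  {ae P, forall w, Z1 w + Z2 w = X w} ->
  choquet (envelope a c1 c2) X <=
    choquet (loaded a c1) Z1 + choquet (@powR R ^~ c2) Z2.
Proof.
move=> iX lX i1 l1 i2 l2 ZX.
have he := concave_distortion_envelope a1 c20 c21 c11.
have el p : envelope a c1 c2 p <= loaded a c1 p by rewrite ge_min lexx.
have ep p : envelope a c1 c2 p <= p `^ c2 by rewrite ge_min lexx orbT.
have [lid1 _] := expectation_choquet i1.
have [lid2 _] := expectation_choquet i2.
have [lidX _] := expectation_choquet iX.
have [ll1 _] := choquet_loaded lid1 l1.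
have p1 : (@powR R ^~ c2) 1 = 1 by rewrite powR1.
have e1 : layer_integrable (envelope a c1 c2) Z1.
  by apply: layer_integrable_envelope lid1 ll1 => //; exact: loaded1.
have e2 : layer_integrable (envelope a c1 c2) Z2.
  by apply: layer_integrable_envelope lid2 l2.
have eX : layer_integrable (envelope a c1 c2) X.
  by apply: layer_integrable_envelope lidX lX.
apply: (le_trans (choquet_subadditive he iX i1 i2 eX e1 e2 ZX)).
apply: lerD; apply: le_choquet => //; first by rewrite loaded1 envelope1.
by rewrite p1 envelope1.
Qed.

End social_cost.

Lemma weighted_sum_minimum (R : realFieldType) (u v x x' y y' : R) :
  0 < u -> 0 < v -> x' <= x -> y' <= y -> u * x + v * y <= u * x' + v * y' ->
  x' = x /\ y' = y.
Proof.
move=> u0 v0 xx yy le; have ux : u * x' <= u * x by rewrite ler_pM2l.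
have vy : v * y' <= v * y by rewrite ler_pM2l.
split; apply/eqP; rewrite eq_le ?xx ?yy/=.
  by rewrite -(ler_pM2l u0); lra.
by rewrite -(ler_pM2l v0); lra.
Qed.

Theorem corollary1 (dT : measure_display) (T : measurableType dT)
    (R : realType) (P : probability T R) (X : {RV P >-> R})
    (b1 theta c1 c2 : R) (g1 g2 : R -> R)
    (hb1 : 0 < b1) (hb1theta : b1 < theta)
    (hg1 : concave_distortion g1) (hg2 : concave_distortion g2)
    (hX0 : {ae P, forall w, 0 <= X w})
    (hX : distortion_risk g2 X \is a fin_num)
    (hc2 : 0 < c2) (hc21 : c2 < c1) (hc1 : c1 < 1)
    (hg1E : forall p : R, 0 <= p <= 1 -> g1 p = p `^ c1)
    (hg2E : forall p : R, 0 <= p <= 1 -> g2 p = p `^ c2) :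
  deductible_insurance_optimal (V_insurer b1 theta g1) (V_buyer theta g2) X.
Proof.
have th0 : 0 < theta := lt_trans hb1 hb1theta.
have tb0 : 0 < theta - b1 by rewrite subr_gt0.
have c10 : 0 < c1 := lt_trans hc2 hc21.
have c21 : c2 <= 1 := ltW (lt_trans hc21 hc1).
have k0 : 0 < 1 + b1 by rewrite addr_gt0.
have l0 : 0 < 1 + theta by rewrite addr_gt0.
pose a := (1 + b1) * theta / (theta - b1).
have a1 : 1 < a by rewrite /a ltr_pdivlMr// mul1r; nra.
have weigh (h1 h2 e1 e2 h1' h2' e1' e2' : R) : e1 + e2 = e1' + e2' ->
    a * h1 - (a - 1) * e1 + h2 <= a * h1' - (a - 1) * e1' + h2' ->
    theta * ((1 + b1) * h1 - (1 + theta) * e1)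
      + (theta - b1) * (h2 - (1 + theta) * e2)
    <= theta * ((1 + b1) * h1' - (1 + theta) * e1')
      + (theta - b1) * (h2' - (1 + theta) * e2').
  (* The identity behind the choice of the weights and of [a]. *)
  have aggregate (h k e f : R) :
      theta * ((1 + b1) * h - (1 + theta) * e)
        + (theta - b1) * (k - (1 + theta) * f) =
      (theta - b1) * (a * h - (a - 1) * e + k) - (theta - b1) * (1 + theta) * (e + f).
    by rewrite /a; field; rewrite gt_eqF.
  by move=> ee low; rewrite !aggregate ee lerD2r ler_pM2l.
clearbody a.
have v1E (Y : {RV P >-> R}) : (V_insurer b1 theta g1 Y \is a fin_num <->
      P.-integrable [set: T] (EFin \o Y) /\ layer_integrable (@powR R ^~ c1) Y) /\
    (V_insurer b1 theta g1 Y \is a fin_num -> V_insurer b1 theta g1 Y =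
      ((1 + b1) * choquet (@powR R ^~ c1) Y - (1 + theta) * choquet id Y)%:E).
  exact: preferenceE Y k0 l0 c10 hg1E.
have v2E (Y : {RV P >-> R}) : (V_buyer theta g2 Y \is a fin_num <->
      P.-integrable [set: T] (EFin \o Y) /\ layer_integrable (@powR R ^~ c2) Y) /\
    (V_buyer theta g2 Y \is a fin_num ->
      V_buyer theta g2 Y = (choquet (@powR R ^~ c2) Y - (1 + theta) * choquet id Y)%:E).
  by have := preferenceE Y ltr01 l0 hc2 hg2E; rewrite mul1e mul1r.
have lX : layer_integrable (@powR R ^~ c2) X.
  have p1 : g2 1 = 1 by case: hg2.
  have [iff _] := distortion_risk_layer p1 (measurable_concave_distortion X hg2).
  move/iff : hX; congr (integrable _ _ _); apply/funext => t /=.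
  by rewrite /layer !hg2E ?tail_ge0 ?tail_le1// ler01 lexx.
have iX := integrable_of_layer hX0 (layer_integrable_id hX0 hc2 c21 lX).
have [d d0 [below above]] := exists_deductible hX0 a1 hc2 hc21 hc1.
exists d%:E => // Y1; set Y2 : {RV P >-> R} := X \- Y1.
have i1 : P.-integrable [set: T] (EFin \o Y1) by exact: integrable_covered.
have i2 : P.-integrable [set: T] (EFin \o Y2) by exact: (integrableB _ iX i1).
have [id1 _] := expectation_choquet i1.
have l1 : layer_integrable (@powR R ^~ c1) Y1.
  apply: (layer_integrable_power hc2 (ltW hc21) (ltW hc1) id1).
  apply: (layer_integrable_dominated hc2 _ _ lX) => t; last exact: tail_covered_le.
  by move=> t0; rewrite tail_covered t0.
have l2 : layer_integrable (@powR R ^~ c2) Y2.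
  apply: (layer_integrable_dominated hc2 _ _ lX) => t; last exact: tail_retained_le.
  by move=> t0; rewrite tail_retained (lt_le_trans t0 d0) tail_neg.
have YX : {ae P, forall w, Y1 w + Y2 w = X w} by apply: aeW => w /=; rewrite addrC subrK.
have f1 : V_insurer b1 theta g1 Y1 \is a fin_num by apply/(v1E Y1).1.
have f2 : V_buyer theta g2 Y2 \is a fin_num by apply/(v2E Y2).1.
split=> [|Z1 Z2 [ZX fZ1 fZ2]].
  by split.
have [j1 m1] := (v1E Z1).1.1 fZ1.
have [j2 m2] := (v2E Z2).1.1 fZ2.
rewrite (v1E Z1).2// (v1E Y1).2//.
rewrite (v2E Z2).2// (v2E Y2).2// !lee_fin => le1 le2.
have [idZ1 _] := expectation_choquet j1.
have low := envelope_bound a1 hc2 hc21 hc1 iX lX j1 m1 j2 m2 ZX.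
have [ll1 LE1] := choquet_loaded a id1 l1.
have [lZ1 LZ1] := choquet_loaded a idZ1 m1.
have eX : layer_integrable (envelope a c1 c2) X.
  apply: (layer_integrable_envelope a1 hc2 hc21 hc1 _ _ _ lX) => //.
  - by move=> p _; rewrite ge_min lexx orbT.
  - by rewrite powR1.
  - exact: (expectation_choquet iX).1.
have up := choquet_deductible hc2 hc21 d0 below above ll1 l2 eX.
have sumY := choquet_id_sum i1 i2 YX.
have sumZ := choquet_id_sum j1 j2 ZX.
rewrite -up LE1 LZ1 in low.
have cost := weigh _ _ _ _ _ _ _ _ (etrans sumY (esym sumZ)) low.
have [eq1 eq2] := weighted_sum_minimum th0 tb0 le1 le2 cost.
by split; [exact: (congr1 EFin eq1) | exact: (congr1 EFin eq2)].
Qed.
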